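(* Let $n\ge 4$, let $a<b$ be real, let $h=(b-a)/n$ and let $\tau_k=a+kh$ for $0\le k\le n$ be the uniform mesh on $[a,b]$. Let $\rho_{0,0},\dots,\rho_{n,0}\in\mathbb{R}$ be given function values and let $\rho_{0,1},\dots,\rho_{n,1}\in\mathbb{R}$ be slopes. Let $p:[a,b]\to\mathbb{R}$ be the piecewise cubic Hermite interpolant with these values and slopes. Then $p$ is twice continuously differentiable on $[a,b]$ (i.e. $p$ is a cubic spline) if and only if the slopes satisfy the fourth-order Padé compact finite difference equations at all interior nodes, that is, if and only if $$\tfrac16\rho_{k-1,1}+\tfrac23\rho_{k,1}+\tfrac16\rho_{k+1,1}=\frac{1}{2h}\left(\rho_{k+1,0}-\rho_{k-1,0}\right)\qquad\text{for all }1\le k\le n-1,$$ equivalently $$\rho_{k-1,1}+4\rho_{k,1}+\rho_{k+1,1}=\frac{3}{h}\left(\rho_{k+1,0}-\rho_{k-1,0}\right)\qquad\text{for all }1\le k\le n-1.$$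
   Context: The piecewise cubic Hermite interpolant with values $\rho_{k,0}$ and slopes $\rho_{k,1}$ at nodes $\tau_0<\tau_1<\dots<\tau_n$ is the function $p$ on $[\tau_0,\tau_n]$ whose restriction to each $[\tau_k,\tau_{k+1}]$, $0\le k\le n-1$, is the unique polynomial $p_k$ of degree at most $3$ with $p_k(\tau_k)=\rho_{k,0}$, $p_k(\tau_{k+1})=\rho_{k+1,0}$, $p_k'(\tau_k)=\rho_{k,1}$, $p_k'(\tau_{k+1})=\rho_{k+1,1}$. The displayed equations are called the fourth-order Padé compact finite difference scheme because they arise from the $(2,2)$ Padé approximant $\ln(1+\Delta)\approx(\Delta+\Delta^2/2)/(1+\Delta+\Delta^2/6)$, with $\Delta f(x)=f(x+h)-f(x)$, by applying the denominator to $f'$ and the numerator to $f/h$. *)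

(* Defs.v *)
From HB Require Import structures.
From mathcomp Require Import all_boot all_order all_algebra.
From mathcomp Require Import ring lra.
From mathcomp Require Import all_classical all_reals all_analysis.
Set Implicit Arguments.
Unset Strict Implicit.
Unset Printing Implicit Defensive.
Import Order.TTheory GRing.Theory Num.Theory.
Import numFieldNormedType.Exports.
Local Open Scope classical_set_scope.
Local Open Scope ring_scope.

(* Derivatives relative to A: the difference quotient at x is taken along
   points y of A with y != x, so that for A = `[a, b] the derivative is
   one-sided at a and b and values of f outside A are irrelevant. *)
Definition has_derivative_on (R : realType) (A : set R) (f f' : R -> R) : Prop :=
  forall x, A x -> (f y - f x) / (y - x) @[y --> within A x^'] --> f' x.

Definition C2_on (R : realType) (A : set R) (f : R -> R) : Prop :=
  exists f1 f2 : R -> R,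
    [/\ has_derivative_on A f f1, has_derivative_on A f1 f2
      & {within A, continuous f2}].

Definition hermite_cubic (R : realType) (t0 t1 v0 v1 s0 s1 : R)
    (q : {poly R}) : Prop :=
  (size q <= 4)%N /\
  [/\ q.[t0] = v0, q.[t1] = v1, q^`().[t0] = s0 & q^`().[t1] = s1].

Lemma hermite_cubic_exists_unique (R : realType) (t0 t1 v0 v1 s0 s1 : R) :
  t0 < t1 -> exists! q, hermite_cubic t0 t1 v0 v1 s0 s1 q.
Proof.
move=> t01.
have d0 : t1 - t0 != 0 by rewrite subr_eq0 gt_eqF.
set d := t1 - t0 in d0.
pose m := (v1 - v0) / d.
pose c2 := (m - s0) / d.
pose c3 := (s0 + s1 - 2 * m) / d ^+ 2.
pose X0 : {poly R} := 'X - t0%:P.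
pose X1 : {poly R} := 'X - t1%:P.
pose q := v0%:P + s0%:P * X0 + c2%:P * (X0 * X0) + c3%:P * (X0 * X0 * X1).
have m0 : X0 \is monic by exact: monicXsubC.
have m1 : X1 \is monic by exact: monicXsubC.
have s2 : size (X0 * X0) = 3%N.
  by rewrite size_monicM ?monic_neq0// !size_XsubC.
have s3 : size (X0 * X0 * X1) = 4%N.
  by rewrite size_monicM ?monic_neq0 ?rpredM// s2 !size_XsubC.
have sz k (p : {poly R}) : (size p <= 4)%N -> (size (k%:P * p)%R <= 4)%N.
  by move=> ?; rewrite mul_polyC (leq_trans (size_scale_leq _ _)).
have hq : hermite_cubic t0 t1 v0 v1 s0 s1 q.
  split.
    rewrite /q; do ![rewrite (leq_trans (size_polyD _ _)) // geq_max; apply/andP; split];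
      rewrite ?sz ?s2 ?s3 ?size_XsubC //.
    by rewrite (leq_trans (size_polyC_leq1 _)).
  rewrite /q /X0 /X1 !(derivXsubC, derivD, derivM, derivC).
  rewrite !(hornerXsubC, hornerD, hornerM, hornerC).
  by rewrite /c2 /c3 /m /d; split; field.
exists q; split=> // r [szr [r0 r1 r0' r1']].
case: hq => szq [q0 q1 q0' q1'].
pose e := q - r.
have sze : (size e <= 4)%N.
  by rewrite (leq_trans (size_polyD _ _)) // geq_max szq size_polyN.
have e0 : root e t0 by rewrite /root /e hornerD hornerN q0 r0 subrr.
have e1 : root e t1 by rewrite /root /e hornerD hornerN q1 r1 subrr.
have e0' : e^`().[t0] = 0 by rewrite /e derivB hornerD hornerN q0' r0' subrr.
have e1' : e^`().[t1] = 0 by rewrite /e derivB hornerD hornerN q1' r1' subrr.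
have /factor_theorem[u eu] := e0.
have /factor_theorem[v uv] : root u t0.
  by move: e0'; rewrite eu derivM derivXsubC mulr1 hornerD hornerM hornerXsubC subrr mulr0 add0r => /eqP.
have ev : e = v * (X0 * X0) by rewrite eu uv mulrA.
have /factor_theorem[w vw] : root v t1.
  move: e1; rewrite ev /root !hornerM hornerXsubC !mulf_eq0 -/d.
  by rewrite (negbTE d0) !orbF.
have /factor_theorem[z wz] : root w t1.
  move: e1'; rewrite ev vw /X0 !(derivXsubC, derivM) !(hornerXsubC, hornerM, hornerD).
  rewrite subrr hornerC !(mulr0,mul0r,add0r,addr0,mulr1).
  by move=> /eqP; rewrite -/d !mulf_eq0 (negbTE d0) !orbF.
have ez : e = z * (X1 * X1 * (X0 * X0)) by rewrite ev vw wz !mulrA.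
apply/eqP; rewrite -subr_eq0 -/e; apply: contraTT sze => ne0.
have z0 : z != 0 by apply: contraNneq ne0 => z0; rewrite ez z0 mul0r.
have m4 : X1 * X1 * (X0 * X0) \is monic by rewrite !rpredM.
rewrite ez size_Mmonic // !size_monicM ?monic_neq0 ?rpredM // !size_XsubC /=.
by rewrite -ltnNge addnS /= -[4%N]/(0 + 4)%N ltn_add2r size_poly_gt0.
Qed.

Definition hermite_interpolant (R : realType) (n : nat) (tau rho0 rho1 : nat -> R)
    (p : R -> R) : Prop :=
  forall k : nat, (k < n)%N ->
    exists2 q : {poly R},
      hermite_cubic (tau k) (tau k.+1) (rho0 k) (rho0 k.+1)
                    (rho1 k) (rho1 k.+1) q
    & forall x : R, tau k <= x <= tau k.+1 -> p x = q.[x].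

(* Main.v *)
(* On each mesh interval p is a cubic, so by uniqueness of one-sided limits any
   first and second derivatives of p relative to [a, b] restrict to the formal
   derivatives of the pieces. Conversely, the derivatives of the pieces glue as
   soon as they agree at the interior nodes, because the mesh intervals form a
   finite closed cover of [a, b]. The first derivatives agree by construction,
   so p is C^2 iff the second derivatives of adjacent pieces agree; their jump
   at the node k is 2 / h times the residual of the k-th compact equation. *)
Require Import Defs.
From HB Require Import structures.
From mathcomp Require Import all_boot all_order all_algebra.
From mathcomp Require Import zify ring lra.
From mathcomp Require Import all_classical all_reals all_analysis.
Set Implicit Arguments.
Unset Strict Implicit.
Unset Printing Implicit Defensive.
Import Order.TTheory GRing.Theory Num.Theory.
Import numFieldNormedType.Exports.
Local Open Scope classical_set_scope.
Local Open Scope ring_scope.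

(** * Limits of difference quotients relative to a set *)

Lemma horner_diff_quotient_cvg (R : realType) (q : {poly R}) (x : R) :
  (q.[y] - q.[x]) / (y - x) @[y --> x^'] --> q^`().[x].
Proof.
have /factor_theorem[u qu] : root (q - q.[x]%:P) x.
  by rewrite /root hornerD hornerN hornerC subrr.
have qE : q = u * ('X - x%:P) + q.[x]%:P by rewrite -qu subrK.
have -> : q^`().[x] = u.[x].
  rewrite qE derivD derivC addr0 derivM derivXsubC mulr1 hornerD hornerM.
  by rewrite hornerXsubC subrr mulr0 add0r.
have : u.[y] @[y --> x^'] --> u.[x].
  by apply: cvg_within_filter; exact: continuous_horner.
apply: cvg_trans; apply: near_eq_cvg.
near=> y.
have yx : y - x != 0 by rewrite subr_eq0; near: y; exact: nbhs_dnbhs_neq.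
by rewrite {1}qE hornerD hornerM hornerXsubC hornerC addrK mulfK.
Unshelve. all: by end_near. Qed.

(** Every point of a nondegenerate interval, endpoints included, is a limit of other points of it;
    limits relative to the interval are therefore unique. *)
Lemma within_itvcc_dnbhs_proper (R : realType) (c d x : R) :
  c < d -> c <= x <= d -> ProperFilter (within `[c, d] x^').
Proof.
move=> cd /andP[cx xd]; apply: Build_ProperFilter_ex => P.
move=> /nbhs_ballP[e /= e0 eP].
have H y : `|x - y| < e -> y != x -> c <= y <= d -> P y.
  by move=> xy yx cyd; apply: eP => //=; rewrite in_itv.
have [xd'|dx] := ltP x d.
- have m0 : 0 < Num.min (e / 2) (d - x) by rewrite lt_min divr_gt0// subr_gt0.
  have me : Num.min (e / 2) (d - x) <= e / 2 by rewrite ge_min lexx.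
  have md : Num.min (e / 2) (d - x) <= d - x by rewrite ge_min lexx orbT.
  exists (x + Num.min (e / 2) (d - x)); apply: H.
  + rewrite opprD addNKr normrN gtr0_norm//; lra.
  + by rewrite gt_eqF// ltrDl.
  + by apply/andP; split; lra.
(* Here [x = d], so the nearby point is taken on the left; [e / 2] keeps it in the ball and [d - c]
   keeps it in the interval. *)
- have m0 : 0 < Num.min (e / 2) (d - c) by rewrite lt_min divr_gt0// subr_gt0.
  have me : Num.min (e / 2) (d - c) <= e / 2 by rewrite ge_min lexx.
  have md : Num.min (e / 2) (d - c) <= d - c by rewrite ge_min lexx orbT.
  exists (x - Num.min (e / 2) (d - c)); apply: H.
  + rewrite opprB addrCA subrr addr0 gtr0_norm//; lra.
  + by rewrite lt_eqF// gtrBl.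
  + by apply/andP; split; lra.
Qed.

Lemma cvg_within_eq (T : Type) (U : topologicalType) (F : set_system T)
    (A : set T) (f g : T -> U) (l : U) : Filter F ->
  (forall y, A y -> f y = g y) -> g @ F --> l -> f @ within A F --> l.
Proof.
move=> FF fg gl; have : g @ within A F --> l by exact: cvg_within_filter.
apply: cvg_trans; apply: near_eq_cvg.
by apply: filterS (withinT A FF) => y /= /fg.
Qed.

(** The limit along [A] persists along the smaller set [[c, d]], where the quotient is that of [q];
    uniqueness of limits then identifies the two values. *)
Lemma has_derivative_on_poly_uniq (R : realType) (A : set R) (f f' : R -> R)
    (c d : R) (q : {poly R}) :
    c < d -> `[c, d] `<=` A -> has_derivative_on A f f' ->
    (forall x, c <= x <= d -> f x = q.[x]) ->
  forall x, c <= x <= d -> f' x = q^`().[x].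
Proof.
move=> cd cdA ff' fq x xcd.
have FF := within_itvcc_dnbhs_proper cd xcd.
have l1 : (f y - f x) / (y - x) @[y --> within `[c, d] x^'] --> f' x.
  apply: cvg_trans (ff' x _); last by apply: cdA; rewrite /= in_itv.
  by apply: cvg_app; exact: within_subset.
have l2 : (f y - f x) / (y - x) @[y --> within `[c, d] x^'] --> q^`().[x].
  apply: cvg_within_eq (@horner_diff_quotient_cvg _ q x) => y /=.
  by rewrite in_itv/= => ycd; rewrite !fq.
exact: (cvg_unique (@Rhausdorff R) l1 l2).
Qed.

(** Only the pieces through [x] matter, and finitely many eventual conditions hold together. With
    [F] general, punctured neighbourhoods serve for derivatives and full ones for continuity. *)
Lemma cvg_within_closed_cover (R : realType) (T : topologicalType) (n : nat)
    (A : set R) (B : nat -> set R) (F : set_system R) (x : R)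
    (f : R -> T) (l : T) :
    Filter F -> F --> x -> (forall k, closed (B k)) ->
    (forall y, A y -> exists2 k, (k < n)%N & B k y) ->
    (forall k, (k < n)%N -> B k x -> f @ within (B k) F --> l) ->
  f @ within A F --> l.
Proof.
move=> FF Fx Bcl AB fl U lU.
have key k : (k < n)%N -> F [set y | B k y -> U (f y)].
  move=> kn; have [Bx|nBx] := pselect (B k x); first exact: (fl k kn Bx U lU).
  have : F (~` B k).
    (* A closed piece missing [x] is eventually avoided by [F], which makes the implication
       vacuous. *)
    by apply: Fx; apply: open_nbhs_nbhs; split => //; exact: closed_openC.
  by apply: filterS => y nBy /nBy.
have := @filter_forall _ _ (fun (k : 'I_n) y => B k y -> U (f y)) F FF
  (fun k => key k (ltn_ord k)).
apply: filterS => y Hy Ay; have [k kn Bky] := AB y Ay.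
exact: (Hy (Ordinal kn)).
Qed.

(** * Gluing polynomial pieces along a mesh *)

Section piecewise_polynomial.
Context {R : realType}.
Implicit Types (n k : nat) (t : nat -> R) (Q : nat -> {poly R}).

Lemma mesh_le n t : (forall k, (k < n)%N -> t k < t k.+1) ->
  forall i j, (i <= j <= n)%N -> t i <= t j.
Proof.
move=> tS i; elim=> [|j IH]; first by rewrite leqn0 => /andP[/eqP ->].
move=> /andP[]; rewrite leq_eqVlt => /predU1P[->//|ij jn].
by rewrite (le_trans (IH _)) ?(ltW (tS _ _))// -ltnS ij ltnW.
Qed.

Lemma mesh_cover n t x : (0 < n)%N -> t 0%N <= x <= t n ->
  exists2 k, (k < n)%N & t k <= x <= t k.+1.
Proof.
elim: n => // -[|n] IH _ /andP[t0 tn]; first by exists 0%N; rewrite ?t0.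
have [xn|/ltW nx] := leP x (t n.+1).
  by have [|k kn ?] := IH isT; [rewrite t0|exists k => //; rewrite ltnS ltnW].
by exists n.+1 => //; rewrite nx.
Qed.

(** Supplies the candidates for the first and second derivatives. By induction on the number of
    pieces, the last polynomial is appended on the right. *)
Lemma piecewise_glue n t Q :
    (forall k, (k < n)%N -> t k < t k.+1) ->
    (forall k, (k.+1 < n)%N -> (Q k).[t k.+1] = (Q k.+1).[t k.+1]) ->
  exists f : R -> R, forall k, (k < n)%N ->
    forall x, t k <= x <= t k.+1 -> f x = (Q k).[x].
Proof.
elim: n => [|[|n] IH] tS QE; first by exists (fun=> 0).
  by exists (fun x => (Q 0).[x]) => -[].
have [||f fQ] := IH.
- by move=> k kn; rewrite tS// ltnS ltnW.
- by move=> k kn; rewrite QE// ltnS ltnW.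
exists (fun x => if x <= t n.+1 then f x else (Q n.+1).[x]) => k.
rewrite ltnS leq_eqVlt => /predU1P[-> x /andP[nx _]|kn x /andP[kx xk]].
  (* The last piece meets the branch of the earlier ones only at their common node, where [QE]
     applies. *)
  case: leP => // xn; have -> : x = t n.+1 by apply/eqP; rewrite eq_le xn.
  by rewrite (fQ n)// ?QE// lexx andbT ltW// tS.
rewrite (fQ k) ?kx//; case: leP => //; rewrite ltNge => /negP[].
by rewrite (le_trans xk)// (mesh_le tS)// kn/=.
Qed.

Lemma has_derivative_on_piecewise n t Q f f' : (0 < n)%N ->
    (forall k, (k < n)%N -> forall x, t k <= x <= t k.+1 -> f x = (Q k).[x]) ->
    (forall k, (k < n)%N -> forall x, t k <= x <= t k.+1 ->
      f' x = (Q k)^`().[x]) ->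
  has_derivative_on `[t 0%N, t n] f f'.
Proof.
move=> n0 fQ fQ' x _.
refine (@cvg_within_closed_cover R _ n _ (fun k => [set` `[t k, t k.+1]])
  _ x _ _ _ _ _ _ _).
- exact: cvg_within.
- by move=> k; exact: itv_closed.
- move=> y; rewrite /= in_itv/= => /(mesh_cover n0)[k kn yk].
  by exists k => //=; rewrite in_itv.
- move=> k kn; rewrite /= in_itv/= => xk; rewrite (fQ' k)//.
  apply: cvg_within_eq (@horner_diff_quotient_cvg _ (Q k) x) => y /=.
  by rewrite in_itv/= => yk; rewrite !(fQ k).
Qed.

Lemma continuous_piecewise n t Q (f : R -> R) : (0 < n)%N ->
    (forall k, (k < n)%N -> forall x, t k <= x <= t k.+1 -> f x = (Q k).[x]) ->
  {within `[t 0%N, t n], continuous f}.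
Proof.
move=> n0 fQ; apply/subspace_continuousP => x _.
refine (@cvg_within_closed_cover R _ n _ (fun k => [set` `[t k, t k.+1]])
  _ x _ _ _ _ _ _ _).
- exact: cvg_id.
- by move=> k; exact: itv_closed.
- move=> y; rewrite /= in_itv/= => /(mesh_cover n0)[k kn yk].
  by exists k => //=; rewrite in_itv.
- move=> k kn; rewrite /= in_itv/= /from_subspace => xk; rewrite (fQ k)//.
  apply: cvg_within_eq (@continuous_horner _ (Q k) x) => y /=.
  by rewrite in_itv/= => yk; rewrite !(fQ k).
Qed.

Lemma C2_on_piecewiseP n t Q (p : R -> R) : (0 < n)%N ->
    (forall k, (k < n)%N -> t k < t k.+1) ->
    (forall k, (k < n)%N -> forall x, t k <= x <= t k.+1 -> p x = (Q k).[x]) ->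
    (forall k, (k.+1 < n)%N -> (Q k)^`().[t k.+1] = (Q k.+1)^`().[t k.+1]) ->
  C2_on `[t 0%N, t n] p <->
  (forall k, (k.+1 < n)%N ->
    (Q k)^`()^`().[t k.+1] = (Q k.+1)^`()^`().[t k.+1]).
Proof.
move=> n0 tS pQ Q1; split=> [[f1 [f2 [pf1 f12 _]]] k kn|Q2].
  have sub j : (j < n)%N -> `[t j, t j.+1] `<=` `[t 0%N, t n].
    move=> jn y; rewrite /= !in_itv/= => /andP[jy yj].
    rewrite (le_trans (mesh_le tS _) jy) ?(ltnW jn)//=.
    by rewrite (le_trans yj)// (mesh_le tS)// jn leqnn.
  have f2E j : (j < n)%N -> forall x, t j <= x <= t j.+1 ->
      f2 x = (Q j)^`()^`().[x].
    (* Uniqueness is used twice: for [p], identifying [f1] on the piece, and then for [f1]. *)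
    move=> jn; apply: (has_derivative_on_poly_uniq (tS _ jn) (sub _ jn) f12).
    by apply: (has_derivative_on_poly_uniq (tS _ jn) (sub _ jn) pf1); exact: pQ.
  (* The node lies in both adjacent intervals, so both sides equal [f2] there. *)
  by rewrite -!f2E// ?lexx ?(ltW (tS _ _)) ?(ltnW kn).
have [f1 f1Q] := @piecewise_glue n t (fun k => (Q k)^`()) tS Q1.
have [f2 f2Q] := @piecewise_glue n t (fun k => (Q k)^`()^`()) tS Q2.
exists f1, f2; split.
- exact: has_derivative_on_piecewise pQ f1Q.
- exact: has_derivative_on_piecewise f1Q f2Q.
- exact: continuous_piecewise f2Q.
Qed.

End piecewise_polynomial.

(** * From second derivatives at the nodes to the compact scheme *)

Lemma hermite_cubic_deriv2 (R : realType) (t0 t1 v0 v1 s0 s1 : R)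
    (q : {poly R}) : t0 < t1 -> hermite_cubic t0 t1 v0 v1 s0 s1 q ->
  q^`()^`().[t0] =
    (6 * (v1 - v0) / (t1 - t0) - 4 * s0 - 2 * s1) / (t1 - t0) /\
  q^`()^`().[t1] =
    (2 * s0 + 4 * s1 - 6 * (v1 - v0) / (t1 - t0)) / (t1 - t0).
Proof.
(* The data are replaced by values of [q] and its derivative, so no system is solved: both claims
   become identities in the four coefficients of [q]. *)
move=> t01 [sq [<- <- <- <-]].
have d0 : t1 - t0 != 0 by rewrite subr_eq0 gt_eqF.
have qE : q = \poly_(i < 4) q`_i.
  apply/polyP => i; rewrite coef_poly; case: ltnP => // i4.
  by rewrite nth_default// (leq_trans sq).
rewrite qE poly_def !big_ord_recr big_ord0 /= add0r.
rewrite !(derivD, derivZ, derivXn, derivMn, hornerE) /=.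
by split; field.
Qed.

Theorem mainTheorem1 (R : realType) (n : nat) (a b h : R)
    (tau rho0 rho1 : nat -> R) (p : R -> R)
    (hn : (4 <= n)%N) (hab : a < b)
    (hh : h = (b - a) / n%:R)
    (htau : forall k : nat, (k <= n)%N -> tau k = a + k%:R * h)
    (hp : hermite_interpolant n tau rho0 rho1 p) :
  (C2_on `[a, b] p <->
   (forall k : nat, (1 <= k <= n - 1)%N ->
      1 / 6 * rho1 (k - 1)%N + 2 / 3 * rho1 k + 1 / 6 * rho1 (k + 1)%N
      = 1 / (2 * h) * (rho0 (k + 1)%N - rho0 (k - 1)%N)))
  /\
  (C2_on `[a, b] p <->
   (forall k : nat, (1 <= k <= n - 1)%N ->
      rho1 (k - 1)%N + 4 * rho1 k + rho1 (k + 1)%N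
      = 3 / h * (rho0 (k + 1)%N - rho0 (k - 1)%N))).
Proof.
have n0 : (0 < n)%N by exact: leq_trans hn.
have nR : (0 : R) < n%:R by rewrite ltr0n.
have h0 : 0 < h by rewrite hh divr_gt0// subr_gt0.
have hN0 : h != 0 by rewrite gt_eqF.
have tauS k : (k < n)%N -> tau k.+1 - tau k = h.
  by move=> kn; rewrite (htau _ kn) (htau _ (ltnW kn)) -natr1; ring.
have tau_lt k : (k < n)%N -> tau k < tau k.+1.
  by move=> kn; rewrite -subr_gt0 tauS.
have -> : a = tau 0%N by rewrite htau// mul0r addr0.
have -> : b = tau n.
  by rewrite htau// hh mulrC divfK ?gt_eqF// addrC subrK.
have /choice[Q HQ] : forall k, exists q : {poly R}, (k < n)%N ->
    hermite_cubic (tau k) (tau k.+1) (rho0 k) (rho0 k.+1)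
                  (rho1 k) (rho1 k.+1) q
    /\ forall x, tau k <= x <= tau k.+1 -> p x = q.[x].
  move=> k; case: (ltnP k n) => [/hp[q ? ?]|_]; last by exists 0.
  by exists q.
(* The equations are indexed by the left neighbour [k] of the interior node [k.+1], which avoids
   truncated subtraction. *)
have C2E : C2_on `[tau 0%N, tau n] p <-> (forall k, (k.+1 < n)%N ->
    rho1 k + 4 * rho1 k.+1 + rho1 k.+2 = 3 / h * (rho0 k.+2 - rho0 k)).
  rewrite (@C2_on_piecewiseP _ n tau Q p)//; first last.
  - move=> k kn; have [[_ [_ _ _ ->]] _] := HQ k (ltnW kn).
    by have [[_ [_ _ -> _]] _] := HQ k.+1 kn.
  - by move=> k /HQ[].
  have E k : (k.+1 < n)%N ->
      (Q k)^`()^`().[tau k.+1] - (Q k.+1)^`()^`().[tau k.+1] =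
      (rho1 k + 4 * rho1 k.+1 + rho1 k.+2 - 3 / h * (rho0 k.+2 - rho0 k))
        * (2 / h).
    move=> kn; have [Hk _] := HQ k (ltnW kn); have [Hk1 _] := HQ k.+1 kn.
    have [_ ->] := hermite_cubic_deriv2 (tau_lt _ (ltnW kn)) Hk.
    have [-> _] := hermite_cubic_deriv2 (tau_lt _ kn) Hk1.
    by rewrite !tauS ?(ltnW kn)//; field.
  (* As [2 / h] is nonzero, the jump vanishes exactly when the residual does. *)
  split=> H k kn; apply/eqP; rewrite -subr_eq0; have := E k kn.
    rewrite H// subrr => /esym/eqP; rewrite mulf_eq0 => /orP[//|].
    by rewrite mulf_eq0 invr_eq0 (negbTE hN0) orbF pnatr_eq0.
  by move=> ->; rewrite H// subrr mul0r.
(* Abstracting the equation as a relation on three indices lets one reindexing serve both forms of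
   the scheme. *)
have shift (P : nat -> nat -> nat -> Prop) :
    (forall k, (1 <= k <= n - 1)%N -> P (k - 1)%N k (k + 1)%N) <->
    (forall k, (k.+1 < n)%N -> P k k.+1 k.+2).
  split=> H k.
    by move=> kn; have := H k.+1; rewrite !subn1 addn1 /=; apply; lia.
  by case: k => // k; rewrite !subn1 addn1 /= => kn; apply: H; lia.
split.
  rewrite C2E (shift (fun i j k => 1 / 6 * rho1 i + 2 / 3 * rho1 j
    + 1 / 6 * rho1 k = 1 / (2 * h) * (rho0 k - rho0 i))).
  (* The two forms differ by the factor [1 / 6]. *)
  split=> H k kn; have := H k kn.
    move=> E; transitivity (1 / 6 * (rho1 k + 4 * rho1 k.+1 + rho1 k.+2)).
      by field.
    by rewrite E; field.
  move=> E; transitivity (6 * (1 / 6 * rho1 k + 2 / 3 * rho1 k.+1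
    + 1 / 6 * rho1 k.+2)); first by field.
  by rewrite E; field.
by rewrite C2E (shift (fun i j k => rho1 i + 4 * rho1 j + rho1 k
  = 3 / h * (rho0 k - rho0 i))).
Qed.
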